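(* Let $P_\bullet=(P_k)_{k=0}^\infty$ be a sequence of matrices in $\mathbb{C}^{d\times d}$ such that $0\prec P_0\prec P_1\prec\cdots$ and $\lim_{k\to\infty}\lVert P_k\rVert=\infty$. Let $A_\bullet=(A_k)_{k=0}^\infty$ be any sequence of matrices in $\mathbb{C}^{d\times d}$ and let $S\in\mathbb{C}^{d\times d}$. If $\sum_{k=0}^\infty A_k=S$ in the conventional sense, then $\sum_{k=0}^\infty A_k$ is summable in Abelian means to $S$ with respect to $P_\bullet$.
   Context: $\lVert\cdot\rVert$ is the spectral norm. $A\succ B$ (equivalently $B\prec A$) is the Loewner order: $A-B$ is positive definite, i.e. $x^*(A-B)x>0$ for all nonzero $x\in\mathbb{C}^d$. A series of matrices equals $S$ in the conventional sense (is conventionally summable to $S$) if its partial sums converge to $S$ in norm. For $P_\bullet$ with $0\prec P_0\prec P_1\prec\cdots$ and $\lim_{k\to\infty}\lVert P_k\rVert=\infty$, the series $\sum_{k=0}^\infty A_k$ is summable in Abelian means to $S$ with respect to $P_\bullet$ if $\sum_{k=0}^\infty A_ke^{-P_kx}$ is conventionally summable for all $x\in(0,\infty)$ and $\lim_{x\to0^+}\sum_{k=0}^\infty A_ke^{-P_kx}=S$, where $e^{(\cdot)}$ is the matrix exponential. *)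

(* Defs.v *)
From mathcomp Require Import all_boot all_order all_algebra.
From mathcomp Require Import spectral complex.
From mathcomp Require Import all_classical all_reals all_analysis.

Set Implicit Arguments.
Unset Strict Implicit.
Unset Printing Implicit Defensive.

Import Order.TTheory GRing.Theory Num.Theory.
Import numFieldNormedType.Exports.

Local Open Scope classical_set_scope.
Local Open Scope ring_scope.
Local Open Scope complex_scope.
Local Open Scope sesquilinear_scope.

Definition l2norm (R : realType) (d : nat) (x : 'cV[R[i]]_d) : R :=
  Num.sqrt (\sum_(i < d) ComplexField.Normc.normc (x i ord0) ^+ 2).

Definition spectral_norm (R : realType) (d : nat) (A : 'M[R[i]]_d) : R :=
  sup [set l2norm (A *m x) | x in [set x : 'cV[R[i]]_d | l2norm x <= 1]].

(* On R[i], 0 < z means that z is real and positive; so [loewner_lt B A] forces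
   A - B to be Hermitian. *)
Definition loewner_lt (R : realType) (d : nat) (B A : 'M[R[i]]_d) : Prop :=
  forall x : 'cV[R[i]]_d, x != 0 ->
    0 < (x^t* *m (A - B) *m x) ord0 ord0.

Definition conv_sum (R : realType) (d : nat) (A : nat -> 'M[R[i]]_d)
    (S : 'M[R[i]]_d) : Prop :=
  spectral_norm (\sum_(0 <= k < n) A k - S) @[n --> \oo] --> (0 : R).

(* [xget] picks the sum of the exponential series, which exists and is unique. *)
Definition expmx (R : realType) (d : nat) (A : 'M[R[i]]_d) : 'M[R[i]]_d :=
  xget 0 [set E | conv_sum (fun k => (k`!%:R)^-1 *: A ^+ k) E].

Definition abel_summable (R : realType) (d : nat) (P A : nat -> 'M[R[i]]_d)
    (S : 'M[R[i]]_d) : Prop :=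
  exists T : R -> 'M[R[i]]_d,
    (forall x : R, 0 < x ->
       conv_sum (fun k => A k *m expmx (- (x%:C *: P k))) (T x)) /\
    spectral_norm (T x - S) @[x --> 0^'+] --> (0 : R).

(* Main.v *)
Require Import Defs.
From mathcomp Require Import all_boot all_order all_algebra.
From mathcomp Require Import spectral complex.
From mathcomp Require Import all_classical all_reals all_analysis.
From mathcomp Require Import ring lra.
Set Implicit Arguments.
Unset Strict Implicit.
Unset Printing Implicit Defensive.
Import Order.TTheory GRing.Theory Num.Theory.
Import numFieldNormedType.Exports.
Local Open Scope classical_set_scope.
Local Open Scope ring_scope.
Local Open Scope complex_scope.


(** Write [E_k(x) = exp (- x P_k)]. Summing by parts,
      [\sum_k A_k E_k = S E_0 + \sum_k r_k (E_k - E_(k+1))]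
    up to a vanishing boundary term, where the remainders [r_k] of the series
    tend to [0]. So the theorem follows once the total variation
    [\sum_k |E_k(x) - E_(k+1)(x)|] is bounded independently of [x], together with
    the fact that each [E_k(x)] tends to the identity as [x] tends to [0]
    ([regular_of_bounded_variation]).

    The obstacle is that the exponential is not operator monotone: the
    differences [E_k - E_(k+1)] need not be nonnegative, and their norms cannot be
    telescoped directly. The resolvent [(1 + P)^-1], however, does decrease when
    the nonnegative matrix [P] increases ([resolvent_antitone]), and
    [exp (- a)] is a Lipschitz function of [1 / (1 + a)] for [a >= 0]
    ([expRN_lip_resolvent]). Lipschitz functions of Hermitian matrices are
    Lipschitz for the Frobenius norm: expressed in the eigenbases of both
    matrices, the inequality reduces to the scalar one, entry by entry
    ([frob2_udiagB_lip]). Finally, on nonnegative matrices the Frobenius norm is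
    at most the trace ([frob2_psdmx_le]). Hence, for [0 <= P <= Q],
      [|exp (- P) - exp (- Q)| <= const * (tr (1 + P)^-1 - tr (1 + Q)^-1)]
    ([expmxN_variation]). Along the increasing sequence [x P_k] the right-hand
    sides telescope, and their sum is at most the constant times [d], since
    [0 <= tr (1 + P)^-1 <= d]. Comparing [0] with [x P_k] in the same inequality
    gives [|E_k(x) - 1| <= const * x tr P_k], which tends to [0] with [x]. *)

(** * Nonnegative matrices and their functional calculus *)

Section PsdMatrices.
Local Open Scope sesquilinear_scope.
Variables (C : numClosedFieldType) (n : nat).
Implicit Types (A B G P Q U V W X : 'M[C]_n) (v w f g : 'rV[C]_n).

Definition psdmx A := forall x : 'cV[C]_n, 0 <= (x^t* *m A *m x) 0 0.

Lemma adjmxM m p q (X : 'M[C]_(m, p)) (Y : 'M[C]_(p, q)) :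
  (X *m Y)^t* = Y^t* *m X^t*.
Proof. by rewrite trmx_mul map_mxM. Qed.

Lemma adjmxD m p (X Y : 'M[C]_(m, p)) : (X + Y)^t* = X^t* + Y^t*.
Proof. by rewrite linearD/= map_mxD. Qed.

Lemma adjmxZ m p a (X : 'M[C]_(m, p)) : (a *: X)^t* = a^* *: X^t*.
Proof. by rewrite linearZ/= map_mxZ. Qed.

Lemma adjmx1 : (1%:M : 'M[C]_n)^t* = 1%:M.
Proof. by rewrite trmx1 map_mx1. Qed.

Lemma psdmxD A B : psdmx A -> psdmx B -> psdmx (A + B).
Proof. by move=> pA pB x; rewrite mulmxDr mulmxDl mxE addr_ge0. Qed.

Lemma psdmx_le A B : psdmx A -> psdmx (B - A) -> psdmx B.
Proof. by move=> pA pBA; rewrite -(subrK A B); exact: psdmxD. Qed.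

Lemma psdmxZ a A : 0 <= a -> psdmx A -> psdmx (a *: A).
Proof. by move=> a0 pA x; rewrite -scalemxAr -scalemxAl mxE mulr_ge0. Qed.

Lemma psdmxZB a A B : 0 <= a -> psdmx (B - A) -> psdmx (a *: B - a *: A).
Proof. by move=> a0 pBA; rewrite -scalerBr; exact: psdmxZ. Qed.

Lemma psdmx0 : psdmx 0.
Proof. by move=> x; rewrite mulmx0 mul0mx mxE. Qed.

Lemma psdmx_congr A B : psdmx A -> psdmx (B^t* *m A *m B).
Proof.
by move=> pA x; have := pA (B *m x); rewrite adjmxM !mulmxA.
Qed.

Lemma quad_form_delta A (i j : 'I_n) :
  ((delta_mx i 0 : 'cV_n)^t* *m A *m (delta_mx j 0 : 'cV_n)) 0 0 = A i j.
Proof.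
have -> : (delta_mx i 0 : 'cV[C]_n)^t* = delta_mx 0 i.
  by rewrite trmx_delta map_delta_mx.
by rewrite -rowE -colE !mxE.
Qed.

(** Polarization with the vectors [e_i + e_j] and [e_i + 'i e_j]. *)
Lemma quad_form_eq0 A :
  (forall x : 'cV_n, (x^t* *m A *m x) 0 0 = 0) -> A = 0.
Proof.
move=> A0.
have Ad0 k : A k k = 0 by rewrite -quad_form_delta A0.
have Aij (i j : 'I_n) c : c^* * A j i + c * A i j = 0.
  have := A0 (delta_mx i 0 + c *: delta_mx j 0).
  rewrite adjmxD adjmxZ !mulmxDl !mulmxDr -!scalemxAl -!scalemxAr.
  have mxD (X Y : 'M[C]_1) : (X + Y) 0 0 = X 0 0 + Y 0 0 by rewrite mxE.
  have mxZ a (X : 'M[C]_1) : (a *: X) 0 0 = a * X 0 0 by rewrite mxE.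
  by rewrite !(mxD, mxZ) !quad_form_delta !Ad0 !(mulr0, addr0, add0r) addrC.
apply/matrixP => i j; rewrite [RHS]mxE.
have /eqP := Aij i j 1; rewrite conjC1 !mul1r addr_eq0 => /eqP e1.
have := Aij i j 'i%R; rewrite conjCi e1 mulrN mulNr opprK -mulrDl -mulr2n.
by move/eqP; rewrite mulf_eq0 mulrn_eq0 /= (negPf (neq0Ci _)) => /eqP.
Qed.

(** The form of [A - A^t*] vanishes because that of [A] is real. *)
Lemma psdmx_hermitian A : psdmx A -> A^t* = A.
Proof.
move=> pA; apply/eqP; rewrite eq_sym -subr_eq0; apply/eqP/quad_form_eq0 => x.
rewrite mulmxBr mulmxBl mxE [X in _ + X]mxE.
have -> : x^t* *m A^t* *m x = (x^t* *m A *m x)^t*.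
  by rewrite !adjmxM trmxCK mulmxA.
rewrite [in X in _ - X]mxE [in X in _ - X]mxE.
have /CrealP -> : (x^t* *m A *m x) 0 0 \is Num.real by apply/ger0_real/pA.
by rewrite subrr.
Qed.

Definition udiag U v := U^t* *m diag_mx v *m U.

Lemma adj_unitaryK U : U \is unitarymx -> U^t* *m U = 1%:M.
Proof.
by move=> uU; rewrite -[X in _ *m X]trmxCK; apply/unitarymxP; rewrite trmxC_unitary.
Qed.

Lemma udiagM U v w : U \is unitarymx ->
  udiag U v *m udiag U w = udiag U (\row_i (v 0 i * w 0 i)).
Proof.
move=> /unitarymxP uU; rewrite /udiag !mulmxA -(mulmxA _ U) uU mulmx1.
by rewrite -(mulmxA (U^t*) (diag_mx v)) mulmx_diag.
Qed.

Lemma udiagD U v w : udiag U v + udiag U w = udiag U (v + w).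
Proof. by rewrite /udiag linearD/= mulmxDr mulmxDl. Qed.

Lemma udiagZ U a v : a *: udiag U v = udiag U (a *: v).
Proof. by rewrite /udiag [in RHS]linearZ/= -scalemxAr -scalemxAl. Qed.

Lemma udiag1 U : U \is unitarymx -> udiag U (const_mx 1) = 1%:M.
Proof. by move=> uU; rewrite /udiag diag_const_mx mulmx1 adj_unitaryK. Qed.

Lemma udiagB U v w : udiag U v - udiag U w = udiag U (v - w).
Proof. by rewrite /udiag linearB/= mulmxBr mulmxBl. Qed.

Lemma udiagX U v k : U \is unitarymx ->
  udiag U v ^+ k = udiag U (\row_i v 0 i ^+ k).
Proof.
move=> uU; elim: k => [|k IH].
  rewrite expr0 -idmxE -(udiag1 uU); congr udiag.
  by apply/rowP => i; rewrite !mxE expr0.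
rewrite exprS IH -mulmxE udiagM//; congr udiag.
by apply/rowP => i; rewrite !mxE exprS.
Qed.

Lemma udiag_poly U v (c : nat -> C) N : U \is unitarymx ->
  \sum_(0 <= k < N) c k *: udiag U v ^+ k =
    udiag U (\row_i \sum_(0 <= k < N) c k * v 0 i ^+ k).
Proof.
move=> uU; elim: N => [|N IH].
  rewrite big_geq// /udiag (_ : \row_i _ = 0) ?linear0 ?mulmx0 ?mul0mx//.
  by apply/rowP => i; rewrite !mxE big_geq.
rewrite big_nat_recr//= IH udiagX// udiagZ udiagD; congr udiag.
by apply/rowP => i; rewrite !mxE big_nat_recr.
Qed.

Lemma udiag0 U : udiag U 0 = 0.
Proof. by rewrite /udiag linear0 mulmx0 mul0mx. Qed.

Lemma udiagN U v : - udiag U v = udiag U (- v).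
Proof. by rewrite /udiag linearN/= mulmxN mulNmx. Qed.

Lemma mxtrace_udiag U v : U \is unitarymx -> \tr (udiag U v) = \sum_i v 0 i.
Proof.
move=> /unitarymxP uU.
by rewrite /udiag mxtrace_mulC mulmxA uU mul1mx mxtrace_diag.
Qed.

Lemma udiag_psdmx U v : (forall i, 0 <= v 0 i) -> psdmx (udiag U v).
Proof.
move=> v0; apply: psdmx_congr => x; rewrite mul_mx_diag mxE sumr_ge0// => i _.
by rewrite !mxE mulrAC mulr_ge0// mulrC -normCK exprn_ge0.
Qed.

Lemma psdmx_udiagP A : psdmx A ->
  exists U v, [/\ U \is unitarymx, forall i, 0 <= v 0 i & A = udiag U v].
Proof.
move=> pA; have hA := psdmx_hermitian pA.
have /orthomx_spectralP AE : A \is normalmx by apply/normalmxP; rewrite hA.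
have uU := spectral_unitarymx A; rewrite invmx_unitary// in AE.
exists (spectralmx A), (spectral_diag A); split => // i.
have := psdmx_congr ((spectralmx A)^t*) pA (delta_mx i 0).
rewrite quad_form_delta trmxCK [X in _ *m X *m _]AE !mulmxA.
rewrite mulmxtVK// (unitarymxP uU) mul1mx.
by rewrite mxE eqxx.
Qed.

(** The square of the Frobenius norm. *)
Definition frob2 A : C := \sum_i \sum_j `|A i j| ^+ 2.

Lemma frob2E A : frob2 A = \tr (A *m A^t*).
Proof.
apply: eq_bigr => i _; rewrite mxE; apply: eq_bigr => j _.
by rewrite !mxE normCK.
Qed.

Lemma frob2_unitary U A V : U \is unitarymx -> V \is unitarymx ->
  frob2 (U *m A *m V^t*) = frob2 A.
Proof.
move=> uU uV; rewrite !frob2E !adjmxM trmxCK !mulmxA.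
rewrite -(mulmxA (U *m A) _ V) adj_unitaryK// mulmx1.
by rewrite mxtrace_mulC !mulmxA adj_unitaryK// mul1mx.
Qed.

(** In the basis of [U] on one side and of [V] on the other, the difference has
    entries [(f_i - g_j) (U V^t* )_ij]: comparing functions of two matrices is
    comparing scalars, entry by entry. *)
Lemma frob2_udiagB_lip U V f g v w (L : C) :
  U \is unitarymx -> V \is unitarymx -> 0 <= L ->
  (forall i j, `|f 0 i - g 0 j| <= L * `|v 0 i - w 0 j|) ->
  frob2 (udiag U f - udiag V g) <= L ^+ 2 * frob2 (udiag U v - udiag V w).
Proof.
move=> uU uV L0 fgvw.
have E a b : frob2 (udiag U a - udiag V b) =
    \sum_i \sum_j (`|a 0 i - b 0 j| ^+ 2 * `|(U *m V^t*) i j| ^+ 2).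
  rewrite -(frob2_unitary _ uU uV) mulmxBr mulmxBl /udiag !mulmxA.
  rewrite (unitarymxP uU) mul1mx mulmxtVK// -mulmxA mul_diag_mx mul_mx_diag.
  apply: eq_bigr => i _; apply: eq_bigr => j _.
  by rewrite -exprMn -normrM !mxE -/(_ i j) mulrBl [X in _ - X]mulrC.
rewrite !E mulr_sumr; apply: ler_sum => i _.
rewrite mulr_sumr; apply: ler_sum => j _.
rewrite [leRHS]mulrA ler_wpM2r ?exprn_ge0// -exprMn.
by rewrite lerXn2r ?nnegrE ?mulr_ge0.
Qed.

Lemma frob2_psdmx_le G : psdmx G -> frob2 G <= (\tr G) ^+ 2.
Proof.
move=> pG; rewrite frob2E (psdmx_hermitian pG).
have [U [v [uU v0 ->]]] := psdmx_udiagP pG.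
rewrite udiagM// !mxtrace_udiag// expr2 mulr_suml ler_sum// => i _.
rewrite mxE ler_wpM2l// (bigD1 i)//= lerDl sumr_ge0//.
Qed.

Definition resolvent_diag v : 'rV[C]_n := \row_i (1 + v 0 i)^-1.

Lemma resolventVl U v : U \is unitarymx -> (forall i, 0 <= v 0 i) ->
  udiag U (resolvent_diag v) *m (1%:M + udiag U v) = 1%:M.
Proof.
move=> uU v0; rewrite -(udiag1 uU) udiagD udiagM//; congr udiag.
apply/rowP => i; rewrite !mxE mulVf// gt_eqF// ltr_wpDr//.
Qed.

Lemma resolventVr U v : U \is unitarymx -> (forall i, 0 <= v 0 i) ->
  (1%:M + udiag U v) *m udiag U (resolvent_diag v) = 1%:M.
Proof.
move=> uU v0; rewrite -(udiag1 uU) udiagD udiagM//; congr udiag.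
apply/rowP => i; rewrite !mxE mulfV// gt_eqF// ltr_wpDr//.
Qed.

Lemma invmx_1D_udiag U v : U \is unitarymx -> (forall i, 0 <= v 0 i) ->
  invmx (1%:M + udiag U v) = udiag U (resolvent_diag v).
Proof.
move=> uU v0; have Vl := resolventVl uU v0; have /mulmx1_unit[_ u1] := Vl.
by rewrite -[LHS]mul1mx -{1}Vl mulmxK.
Qed.

(** With [A] and [B] the two resolvents and [D] the difference of the matrices,
    [A - B = B D B + B D A D B] is a sum of congruences of nonnegative matrices. *)
Lemma resolvent_antitone U V v w : U \is unitarymx -> V \is unitarymx ->
    (forall i, 0 <= v 0 i) -> (forall i, 0 <= w 0 i) ->
    psdmx (udiag V w - udiag U v) ->
  psdmx (udiag U (resolvent_diag v) - udiag V (resolvent_diag w)).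
Proof.
move=> uU uV v0 w0; set D := _ - _ => pD.
have rv0 i : 0 <= resolvent_diag v 0 i by rewrite mxE invr_ge0 addr_ge0.
have rw0 i : 0 <= resolvent_diag w 0 i by rewrite mxE invr_ge0 addr_ge0.
have pA := udiag_psdmx U rv0; have pB := udiag_psdmx V rw0.
have Ar := resolventVr uU v0; have Al := resolventVl uU v0.
have Br := resolventVr uV w0; have Bl := resolventVl uV w0.
have DE : D = (1%:M + udiag V w) - (1%:M + udiag U v).
  by rewrite opprD addrACA subrr add0r.
move: Ar Al Br Bl DE pA pB.
set A := udiag U (resolvent_diag v); set B := udiag V (resolvent_diag w).
set P := 1%:M + _; set Q := 1%:M + _ => Ar Al Br Bl DE pA pB.
have hB := psdmx_hermitian pB; have hD := psdmx_hermitian pD.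
have BDA : B *m D *m A = A - B.
  by rewrite DE mulmxBr mulmxBl Bl mul1mx -mulmxA Ar mulmx1.
have ADB : A *m D *m B = A - B.
  by rewrite DE mulmxBr mulmxBl Al mul1mx -(mulmxA A Q) Br mulmx1.
have -> : A - B = B *m D *m B + B *m D *m A *m D *m B.
  by rewrite BDA !mulmxBl ADB [RHS]addrC subrK.
apply: psdmxD; first by rewrite -{1}hB; exact: psdmx_congr.
have -> : B *m D *m A *m D *m B = (D *m B)^t* *m A *m (D *m B).
  by rewrite adjmxM hB hD !mulmxA.
exact: psdmx_congr.
Qed.

(** The heart of the matter: a function that is Lipschitz in terms of
    [1 / (1 + _)] varies between two comparable matrices by no more than the
    trace of the resolvent does, although it need not be operator monotone. *)
Lemma udiagB_le_resolvent_trace U V v w f g (L : C) :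
    U \is unitarymx -> V \is unitarymx ->
    (forall i, 0 <= v 0 i) -> (forall i, 0 <= w 0 i) ->
    psdmx (udiag V w - udiag U v) -> 0 <= L ->
    (forall i j, `|f 0 i - g 0 j| <= L * `|(1 + v 0 i)^-1 - (1 + w 0 j)^-1|) ->
  forall i j, `|(udiag U f - udiag V g) i j| <=
    L * (\sum_k (1 + v 0 k)^-1 - \sum_k (1 + w 0 k)^-1).
Proof.
move=> uU uV v0 w0 pD L0 fg i j.
have pG := resolvent_antitone uU uV v0 w0 pD.
have -> : \sum_k (1 + v 0 k)^-1 - \sum_k (1 + w 0 k)^-1 =
    \tr (udiag U (resolvent_diag v) - udiag V (resolvent_diag w)).
  rewrite linearB/= !mxtrace_udiag//.
  by congr (_ - _); apply: eq_bigr => k _; rewrite mxE.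
set G := _ - _ in pG *.
have trG0 : 0 <= \tr G.
  by rewrite sumr_ge0// => k _; rewrite -quad_form_delta.
rewrite -(@ler_pXn2r _ 2)// ?nnegrE ?mulr_ge0// exprMn.
apply: le_trans (_ : frob2 (udiag U f - udiag V g) <= _).
  rewrite /frob2 (bigD1 i)//= (bigD1 j)//= -addrA lerDl.
  by rewrite addr_ge0// sumr_ge0// => k _; rewrite ?sumr_ge0// => *; rewrite exprn_ge0.
apply: le_trans (frob2_udiagB_lip (v := resolvent_diag v)
  (w := resolvent_diag w) uU uV L0 _) _.
  by move=> k l; rewrite !mxE.
by rewrite ler_wpM2l ?exprn_ge0// frob2_psdmx_le.
Qed.

End PsdMatrices.

(** * An entrywise norm equivalent to the spectral norm *)

Section EntrywiseNorm.
Variables (R : realType).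
Local Notation normc := ComplexField.Normc.normc.
Local Notation Re := complex.Re.
Local Notation Im := complex.Im.

Lemma normc_ge0 (z : R[i]) : 0 <= normc z.
Proof. by case: z => a b; exact: sqrtr_ge0. Qed.

Lemma ler_normc_sum I (r : seq I) (F : I -> R[i]) :
  normc (\sum_(i <- r) F i) <= \sum_(i <- r) normc (F i).
Proof.
elim/big_ind2 : _ => //; first by rewrite ComplexField.Normc.normc0.
by move=> x a y b xa yb; apply: le_trans (le_normcD _ _) (lerD xa yb).
Qed.

Lemma normc_Re_Im_le (z : R[i]) : normc z <= `|Re z| + `|Im z|.
Proof.
case: z => a b /=; rewrite -(ler_pXn2r (n := 2))// ?nnegrE ?sqrtr_ge0 ?addr_ge0//.
rewrite sqr_sqrtr ?addr_ge0 ?sqr_ge0// sqrrD -[a ^+ 2]real_normK ?num_real//.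
by rewrite -[b ^+ 2]real_normK ?num_real// lerD2r lerDl mulrn_wge0 ?mulr_ge0.
Qed.

Lemma le_normc_Re (z : R[i]) : `|Re z| <= normc z.
Proof. by rewrite -lecR; exact: normc_ge_Re. Qed.

Lemma le_normc_Im (z : R[i]) : `|Im z| <= normc z.
Proof.
case: z => a b /=; rewrite -sqrtr_sqr ler_wsqrtr// lerDr sqr_ge0//.
Qed.

Lemma normc_real (x : R) : normc x%:C = `|x|.
Proof. by rewrite /= expr0n/= addr0 sqrtr_sqr. Qed.

Lemma normc1 : normc (1 : R[i]) = 1.
Proof. by rewrite -[1]/(1%:C) normc_real normr1. Qed.

(** The entrywise l1-norm; the estimates are carried out with it because it is
    elementary, submultiplicative and equivalent to the spectral norm. *)
Definition norm1 m n (A : 'M[R[i]]_(m, n)) : R := \sum_i \sum_j normc (A i j).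

Lemma norm1_ge0 m n (A : 'M[R[i]]_(m, n)) : 0 <= norm1 A.
Proof. by rewrite sumr_ge0// => i _; rewrite sumr_ge0// => j _; exact: normc_ge0. Qed.

Lemma normc_le_norm1 m n (A : 'M[R[i]]_(m, n)) i j : normc (A i j) <= norm1 A.
Proof.
rewrite /norm1 (bigD1 i)//= (bigD1 j)//= -addrA lerDl.
by rewrite addr_ge0// sumr_ge0// => k _; rewrite ?sumr_ge0// => *; exact: normc_ge0.
Qed.

Lemma norm1_eq0 m n (A : 'M[R[i]]_(m, n)) : norm1 A = 0 -> A = 0.
Proof.
move=> A0; apply/matrixP => i j; rewrite mxE; apply: ComplexField.Normc.eq0_normc.
by apply/eqP; rewrite eq_le normc_ge0 andbT -A0 normc_le_norm1.
Qed.

Lemma norm10 m n : norm1 (0 : 'M[R[i]]_(m, n)) = 0.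
Proof.
by rewrite /norm1 big1// => i _; rewrite big1// => j _; rewrite mxE ComplexField.Normc.normc0.
Qed.

Lemma ler_norm1D m n (A B : 'M[R[i]]_(m, n)) : norm1 (A + B) <= norm1 A + norm1 B.
Proof.
rewrite /norm1 -big_split; apply: ler_sum => i _ /=.
rewrite -big_split; apply: ler_sum => j _ /=; rewrite mxE; exact: le_normcD.
Qed.

Lemma norm1N m n (A : 'M[R[i]]_(m, n)) : norm1 (- A) = norm1 A.
Proof. by apply: eq_bigr => i _; apply: eq_bigr => j _; rewrite mxE normcN. Qed.

Lemma ler_norm1_sub m n (B A : 'M[R[i]]_(m, n)) :
  norm1 A <= norm1 B + norm1 (A - B).
Proof. by rewrite -{1}(subrK B A) addrC ler_norm1D. Qed.

Lemma norm1_distC m n (A B : 'M[R[i]]_(m, n)) : norm1 (A - B) = norm1 (B - A).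
Proof. by rewrite -norm1N opprB. Qed.

Lemma ler_norm1_dist m n (B A C : 'M[R[i]]_(m, n)) :
  norm1 (A - C) <= norm1 (A - B) + norm1 (B - C).
Proof. by rewrite -{1}(subrK B A) -addrA ler_norm1D. Qed.

Lemma ler_norm1_sum m n I (r : seq I) (F : I -> 'M[R[i]]_(m, n)) :
  norm1 (\sum_(i <- r) F i) <= \sum_(i <- r) norm1 (F i).
Proof.
elim/big_ind2 : _ => //; first by rewrite norm10.
by move=> x a y b xa yb; apply: le_trans (ler_norm1D _ _) (lerD xa yb).
Qed.

Lemma ler_norm1M m n p (A : 'M[R[i]]_(m, n)) (B : 'M[R[i]]_(n, p)) :
  norm1 (A *m B) <= norm1 A * norm1 B.
Proof.
rewrite /norm1 mulr_suml; apply: ler_sum => i _.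
apply: (@le_trans _ _ (\sum_k \sum_j normc (A i k) * normc (B k j))).
  rewrite exchange_big/=; apply: ler_sum => j _; rewrite mxE.
  apply: le_trans (ler_normc_sum _ _) _; apply: ler_sum => k _.
  by rewrite ComplexField.Normc.normcM.
rewrite mulr_suml; apply: ler_sum => k _; rewrite -mulr_sumr.
rewrite ler_wpM2l ?normc_ge0//.
rewrite [leRHS](bigD1 k)//= lerDl sumr_ge0// => l _.
by rewrite sumr_ge0// => j _; exact: normc_ge0.
Qed.

Lemma norm1_diag n (v : 'rV[R[i]]_n) : norm1 (diag_mx v) = \sum_i normc (v 0 i).
Proof.
apply: eq_bigr => i _; rewrite (bigD1 i)//= mxE eqxx mulr1n big1 ?addr0// => j ji.
by rewrite mxE eq_sym (negPf ji) ComplexField.Normc.normc0.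
Qed.

Lemma l2norm_le_norm1 n (x : 'cV[R[i]]_n) : l2norm x <= norm1 x.
Proof.
have -> : norm1 x = \sum_i normc (x i ord0).
  by apply: eq_bigr => i _; rewrite big_ord1.
set s := \sum_i _; have s0 : 0 <= s.
  by rewrite sumr_ge0// => i _; exact: normc_ge0.
rewrite /l2norm -(ger0_norm s0) -sqrtr_sqr ler_wsqrtr// expr2 mulr_suml.
apply: ler_sum => i _; rewrite expr2 ler_wpM2l ?normc_ge0//.
by rewrite /s (bigD1 i)//= lerDl sumr_ge0// => k _; exact: normc_ge0.
Qed.

Lemma normc_le_l2norm n (x : 'cV[R[i]]_n) i : normc (x i ord0) <= l2norm x.
Proof.
rewrite /l2norm -[leLHS]ger0_norm ?normc_ge0// -sqrtr_sqr ler_wsqrtr//.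
by rewrite (bigD1 i)//= lerDl sumr_ge0// => k _; rewrite exprn_ge0 ?normc_ge0.
Qed.

Lemma l2norm_mulmx_le n (A : 'M[R[i]]_n) (x : 'cV[R[i]]_n) :
  l2norm x <= 1 -> l2norm (A *m x) <= norm1 A.
Proof.
move=> x1; apply: le_trans (l2norm_le_norm1 _) _; apply: ler_sum => i _.
rewrite big_ord1 mxE; apply: le_trans (ler_normc_sum _ _) _.
apply: ler_sum => j _; rewrite ComplexField.Normc.normcM.
rewrite ler_piMr ?normc_ge0//; exact: le_trans (normc_le_l2norm _ _) x1.
Qed.

Lemma spectral_norm_ge0 n (A : 'M[R[i]]_n) : 0 <= spectral_norm A.
Proof.
apply: (@le_trans _ _ (l2norm (A *m 0))); first exact: sqrtr_ge0.
apply: ub_le_sup; first by exists (norm1 A) => _ [x x1 <-]; exact: l2norm_mulmx_le.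
exists 0 => //=; rewrite /l2norm big1 ?sqrtr0// => i _.
by rewrite mxE ComplexField.Normc.normc0 expr0n.
Qed.

Lemma spectral_norm_le_norm1 n (A : 'M[R[i]]_n) : spectral_norm A <= norm1 A.
Proof.
apply: ge_sup; last by move=> _ [x x1 <-]; exact: l2norm_mulmx_le.
exists (l2norm (A *m 0)), 0 => //=; rewrite /l2norm big1 ?sqrtr0// => i _.
by rewrite mxE ComplexField.Normc.normc0 expr0n.
Qed.

(** Column [j] of [A] is the image of a unit vector. *)
Lemma normc_le_spectral_norm n (A : 'M[R[i]]_n) i j :
  normc (A i j) <= spectral_norm A.
Proof.
have -> : A i j = (A *m (delta_mx j ord0 : 'cV[R[i]]_n)) i ord0 by rewrite -colE mxE.
apply: le_trans (normc_le_l2norm _ _) _; apply: ub_le_sup.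
  by exists (norm1 A) => _ [x x1 <-]; exact: l2norm_mulmx_le.
exists (delta_mx j ord0) => //=; rewrite /l2norm (bigD1 j)//=.
rewrite [delta_mx _ _ j _]mxE !eqxx normc1 expr1n big1 ?addr0 ?sqrtr1// => k kj.
have -> : (delta_mx j ord0 : 'cV[R[i]]_n) k ord0 = 0 by rewrite mxE (negPf kj).
by rewrite ComplexField.Normc.normc0 expr0n.
Qed.

Lemma norm1_le_spectral_norm n (A : 'M[R[i]]_n) :
  norm1 A <= n%:R ^+ 2 * spectral_norm A.
Proof.
apply: (@le_trans _ _ (\sum_(i < n) \sum_(j < n) spectral_norm A)).
  by apply: ler_sum => i _; apply: ler_sum => j _; exact: normc_le_spectral_norm.
by rewrite !sumr_const !card_ord expr2 -mulrnA -[leLHS]mulr_natl natrM.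
Qed.

Lemma cvg_spectral_norm0 n T (F : set_system T) (FF : Filter F) (u : T -> 'M[R[i]]_n) :
  spectral_norm (u x) @[x --> F] --> (0 : R) <-> norm1 (u x) @[x --> F] --> (0 : R).
Proof.
split => u0.
  apply: (@squeeze_cvgr _ _ _ _ (fun=> 0) (fun x => n%:R ^+ 2 * spectral_norm (u x))).
  - by apply: nearW => x; rewrite norm1_ge0 norm1_le_spectral_norm.
  - exact: cvg_cst.
  - by rewrite -[X in _ --> X](mulr0 (n%:R ^+ 2)); apply: cvgM => //; exact: cvg_cst.
apply: (@squeeze_cvgr _ _ _ _ (fun=> 0) (fun x => norm1 (u x))) => //.
- by apply: nearW => x; rewrite spectral_norm_ge0 spectral_norm_le_norm1.
- exact: cvg_cst.
Qed.

Lemma conv_sumP n (A : nat -> 'M[R[i]]_n) S :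
  conv_sum A S <-> norm1 (\sum_(0 <= k < N) A k - S) @[N --> \oo] --> (0 : R).
Proof. exact: cvg_spectral_norm0. Qed.

Lemma conv_sum_unique n (A : nat -> 'M[R[i]]_n) S T :
  conv_sum A S -> conv_sum A T -> S = T.
Proof.
move=> /conv_sumP AS /conv_sumP AT.
apply/eqP; rewrite -subr_eq0; apply/eqP/norm1_eq0/eqP.
rewrite eq_le norm1_ge0 andbT.
rewrite -[leRHS](addr0 (0 : R)); apply: (cvgr_to_ge (cvgD AS AT)).
apply: nearW => N; apply: le_trans (ler_norm1_dist (\sum_(0 <= k < N) A k) S T) _.
by rewrite norm1_distC.
Qed.

Lemma cvg_sum0 I (r : seq I) T (F : set_system T) (FF : Filter F) (f : I -> T -> R) :
  (forall i, f i x @[x --> F] --> (0 : R)) ->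
  \sum_(i <- r) f i x @[x --> F] --> (0 : R).
Proof.
move=> f0; elim: r => [|i r IH].
  have -> : (fun x => \sum_(i <- [::]) f i x) = (fun=> 0 : R).
    by apply/funext => x; rewrite big_nil.
  exact: cvg_cst.
have -> : (fun x => \sum_(j <- i :: r) f j x) =
    (fun x => f i x + \sum_(j <- r) f j x).
  by apply/funext => x; rewrite big_cons.
have h := cvgD (f0 i) IH; rewrite addr0 in h; exact: h.
Qed.

(** Completeness of the space of matrices, read off the real and imaginary parts
    of the entries. *)
Lemma norm1_summable n (B : nat -> 'M[R[i]]_n) (c : R) :
  (forall N, \sum_(0 <= k < N) norm1 (B k) <= c) ->
  exists W, conv_sum B W.
Proof.
move=> Bc.
have cvg_part (u : nat -> R) : (forall k, `|u k| <= norm1 (B k)) -> cvgn (series u).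
  move=> uB; apply: normed_cvg; apply: nondecreasing_is_cvgn.
    by apply: nondecreasing_series => k _ _; exact: normr_ge0.
  exists c => _ [N _ <-]; apply: le_trans (Bc N).
  by apply: ler_sum => k _; exact: uB.
pose re i j k := Re (B k i j); pose im i j k := Im (B k i j).
have re_cvg i j : cvgn (series (re i j)).
  by apply: cvg_part => k; apply: le_trans (le_normc_Re _) (normc_le_norm1 _ _ _).
have im_cvg i j : cvgn (series (im i j)).
  by apply: cvg_part => k; apply: le_trans (le_normc_Im _) (normc_le_norm1 _ _ _).
exists (\matrix_(i, j) Complex (limn (series (re i j))) (limn (series (im i j)))).
apply/conv_sumP; apply: cvg_sum0 => i; apply: cvg_sum0 => j.
apply: (@squeeze_cvgr _ _ _ _ (fun=> 0) (fun N =>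
  `|series (re i j) N - limn (series (re i j))| +
  `|series (im i j) N - limn (series (im i j))|)).
- apply: nearW => N; rewrite normc_ge0/=; apply: le_trans (normc_Re_Im_le _) _.
  rewrite !mxE summxE.
  have ReE : Re (\sum_(0 <= k < N) B k i j) = series (re i j) N.
    by rewrite /series/= (big_morph _ (raddfD (@complex.Re R)) (raddf0 _)).
  have ImE : Im (\sum_(0 <= k < N) B k i j) = series (im i j) N.
    by rewrite /series/= (big_morph _ (raddfD (@complex.Im R)) (raddf0 _)).
  rewrite -ReE -ImE; case: (\sum_(0 <= k < N) B k i j) => a b; exact: lexx.
- exact: cvg_cst.
- have limB (u : nat -> R) : cvgn u -> `|u N - limn u| @[N --> \oo] --> (0 : R).
    by move=> cu; apply/norm_cvg0P; apply/subr_cvg0.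
  have h := cvgD (limB _ (re_cvg i j)) (limB _ (im_cvg i j)).
  by rewrite addr0 in h; exact: h.
Qed.

Lemma norm1_conv_sum_le n (B : nat -> 'M[R[i]]_n) W (c : R) :
  conv_sum B W -> (forall N, norm1 (\sum_(0 <= k < N) B k) <= c) -> norm1 W <= c.
Proof.
move=> /conv_sumP BW Bc; rewrite -[leRHS]addr0.
apply: (cvgr_to_ge (f := fun N => c + norm1 (\sum_(0 <= k < N) B k - W))
  (F := \oo)).
  by apply: cvgD => //; exact: cvg_cst.
apply: nearW => N; rewrite -{1}(subrK (\sum_(0 <= k < N) B k) W) addrC.
by apply: le_trans (ler_norm1D _ _) _; rewrite norm1_distC lerD2r.
Qed.

End EntrywiseNorm.

(** * Summation methods given by multipliers of bounded variation *)

Section VariationSummability.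
Variables (R : realType) (n : nat).

(** Abel's summation by parts, with the remainder [\sum_(j < k) A j - S]. *)
Lemma summation_by_parts (A E : nat -> 'M[R[i]]_n) S N :
  let r k := \sum_(0 <= j < k) A j - S in
  \sum_(0 <= k < N) A k *m E k =
    S *m E 0%N + r N *m E N + \sum_(0 <= k < N) r k.+1 *m (E k - E k.+1).
Proof.
move=> r; elim: N => [|N IH].
  by rewrite !big_geq// /r big_geq// sub0r mulNmx addr0 subrr.
rewrite !big_nat_recr//= IH.
have -> : A N *m E N = r N.+1 *m E N - r N *m E N.
  rewrite -mulmxBl; congr (_ *m _).
  by rewrite /r big_nat_recr//= opprB addrA subrK addrAC subrr add0r.
rewrite mulmxBr.
have cancel (a p q s : 'M[R[i]]_n) : a + p + (s + (q - p)) = a + s + q.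
  by rewrite [q - p]addrC !addrA (addrAC a p s) addrK.
by rewrite -[LHS]addrA !cancel.
Qed.

(** Multipliers of uniformly bounded variation that tend to the identity form a
    regular summation method: after summation by parts, the remainders beyond
    some rank are uniformly small and are integrated against a bounded
    variation, while finitely many terms remain, each of which vanishes in the
    limit. *)
Lemma regular_of_bounded_variation (E : R -> nat -> 'M[R[i]]_n) (c : R)
    (A : nat -> 'M[R[i]]_n) (S : 'M[R[i]]_n) :
    (forall x N, 0 < x -> \sum_(0 <= k < N) norm1 (E x k - E x k.+1) <= c) ->
    (forall x k, 0 < x -> norm1 (E x k) <= c) ->
    (forall k, norm1 (E x k - 1%:M) @[x --> 0^'+] --> (0 : R)) ->
    conv_sum A S ->
  exists T : R -> 'M[R[i]]_n,
    (forall x, 0 < x -> conv_sum (fun k => A k *m E x k) (T x)) /\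
    spectral_norm (T x - S) @[x --> 0^'+] --> (0 : R).
Proof.
move=> Evar Ebd E1 /conv_sumP AS.
pose r k := \sum_(0 <= j < k) A j - S.
have c0 : 0 <= c by apply: le_trans (Ebd 1 0%N _); rewrite ?norm1_ge0.
have [M M0 rM] : exists2 M, 0 <= M & forall k, norm1 (r k) <= M.
  have /bounded_fun_has_ubound[M MP] := cvg_seq_bounded (cvgP _ AS).
  have rM k : norm1 (r k) <= M by apply: MP; exists k.
  by exists M => //; apply: le_trans (rM 0%N); exact: norm1_ge0.
pose B x k := r k.+1 *m (E x k - E x k.+1).
have Wex x : exists W, 0 < x -> conv_sum (B x) W.
  have [x0|_] := ltP 0 x; last by exists 0.
  suff [W HW] : exists W, conv_sum (B x) W by exists W.
  apply: (norm1_summable (c := M * c)) => N.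
  apply: (@le_trans _ _ (\sum_(0 <= k < N) M * norm1 (E x k - E x k.+1))).
    apply: ler_sum => k _; apply: le_trans (ler_norm1M _ _) _.
    by rewrite ler_wpM2r ?norm1_ge0.
  by rewrite -mulr_sumr ler_wpM2l// Evar.
have [W WP] := boolp.choice Wex.
exists (fun x => S *m E x 0%N + W x); split => [x x0|].
  apply/conv_sumP; have /conv_sumP BW := WP x x0.
  apply: (@squeeze_cvgr _ _ _ _ (fun=> 0) (fun N =>
    norm1 (r N) * c + norm1 (\sum_(0 <= k < N) B x k - W x))).
  - apply: nearW => N; rewrite norm1_ge0/= (summation_by_parts _ _ S).
    rewrite -/(r N) opprD addrACA [S *m _ + _]addrC addrK.
    apply: le_trans (ler_norm1D _ _) _; rewrite lerD2r.
    by apply: le_trans (ler_norm1M _ _) _; rewrite ler_wpM2l ?norm1_ge0// Ebd.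
  - exact: cvg_cst.
  - have h := cvgD (cvgM AS (cvg_cst c)) BW; rewrite mul0r addr0 in h; exact: h.
apply/cvg_spectral_norm0/cvgr0Pnorm_le => e e0.
(* [c] may vanish, hence the denominator [c + 1]. *)
pose e1 := e / 2 / (c + 1).
have c1 : 0 < c + 1 by rewrite ltr_wpDl.
have e10 : 0 < e1 by rewrite !divr_gt0.
have [K _ rK] : \forall k \near \oo, norm1 (r k) <= e1.
  have /cvgr0Pnorm_le/(_ e1 e10) := AS.
  by apply: filterS => k; rewrite ger0_norm ?norm1_ge0.
(* The part of the error that involves finitely many terms only. *)
pose h x := norm1 S * norm1 (E x 0%N - 1%:M) + \sum_(0 <= k < K)
  norm1 (r k.+1) * (norm1 (E x k - 1%:M) + norm1 (E x k.+1 - 1%:M)).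
have h0 : h x @[x --> 0^'+] --> (0 : R).
  have hS : norm1 S * norm1 (E x 0%N - 1%:M) @[x --> 0^'+] --> (0 : R).
    have hS' := cvgM (cvg_cst (norm1 S)) (E1 0%N).
    by rewrite mulr0 in hS'; exact: hS'.
  have hsum : \sum_(0 <= k < K) norm1 (r k.+1) *
      (norm1 (E x k - 1%:M) + norm1 (E x k.+1 - 1%:M)) @[x --> 0^'+] --> (0 : R).
    apply: cvg_sum0 => k.
    have hk := cvgM (cvg_cst (norm1 (r k.+1))) (cvgD (E1 k) (E1 k.+1)).
    rewrite addr0 mulr0 in hk; exact: hk.
  have hh := cvgD hS hsum; rewrite addr0 in hh; exact: hh.
have e20 : 0 < e / 2 by rewrite divr_gt0.
have /cvgr0Pnorm_le/(_ _ e20) hsmall := h0.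
near=> x.
have x0 : 0 < x by near: x; exact: nbhs_right_gt.
have hx : h x <= e / 2.
  by apply: le_trans (ler_norm _) _; near: x; exact: hsmall.
rewrite ger0_norm ?norm1_ge0//.
have /conv_sumP BW := WP x x0.
have WT : norm1 (W x) <= \sum_(0 <= k < K)
    norm1 (r k.+1) * (norm1 (E x k - 1%:M) + norm1 (E x k.+1 - 1%:M)) + e1 * c.
  apply: norm1_conv_sum_le (WP x x0) _ => N.
  apply: (@le_trans _ _ (\sum_(0 <= k < K + N) norm1 (B x k))).
    apply: le_trans (ler_norm1_sum _ _) _.
    rewrite (@big_cat_nat _ _ _ N _ (K + N))//= ?leq_addl// lerDl.
    by rewrite sumr_ge0// => k _; exact: norm1_ge0.
  rewrite (@big_cat_nat _ _ _ K _ (K + N))//= ?leq_addr//; apply: lerD.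
    apply: ler_sum => k _; apply: le_trans (ler_norm1M _ _) _.
    rewrite ler_wpM2l ?norm1_ge0//.
    by rewrite (norm1_distC (E x k.+1)) ler_norm1_dist.
  apply: (@le_trans _ _ (e1 * \sum_(0 <= k < K + N) norm1 (E x k - E x k.+1))).
    rewrite [in leRHS](@big_cat_nat _ _ _ K _ (K + N))//= ?leq_addr//.
    rewrite mulrDr -[leLHS]add0r lerD//.
      by rewrite mulr_ge0 ?(ltW e10)// sumr_ge0// => k _; exact: norm1_ge0.
    rewrite mulr_sumr !big_nat; apply: ler_sum => k /andP[Kk _].
    apply: le_trans (ler_norm1M _ _) _; rewrite ler_wpM2r ?norm1_ge0//.
    by apply: rK; rewrite /= (leq_trans Kk).
  by rewrite ler_wpM2l ?(ltW e10)// Evar.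
have -> : S *m E x 0%N + W x - S = S *m (E x 0%N - 1%:M) + W x.
  by rewrite mulmxBr mulmx1 addrAC.
apply: le_trans (ler_norm1D _ _) _.
apply: (@le_trans _ _ (h x + e1 * c)).
  by rewrite /h -addrA lerD ?ler_norm1M.
rewrite [leRHS]splitr lerD// /e1 -mulrA ler_piMr ?(ltW e20)//.
by rewrite mulrC ler_pdivrMr// mul1r lerDl.
Unshelve. all: by end_near. Qed.

End VariationSummability.

(** * Exponentials of nonnegative matrices *)

Section MatrixExponential.
Local Open Scope sesquilinear_scope.
Variables (R : realType) (n : nat).
Implicit Types (P Q U : 'M[R[i]]_n) (a b : 'I_n -> R).

(** The function [t |-> exp (1 - 1 / t)] is flat at [0], hence Lipschitz on
    [0, 1]; here [t = 1 / (1 + a)]. *)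
Lemma expRN_lip_resolvent (a b : R) : 0 <= a -> 0 <= b ->
  `|expR (- a) - expR (- b)| <= 8 * `|(1 + a)^-1 - (1 + b)^-1|.
Proof.
move=> a0 b0; wlog ab : a b a0 b0 / a <= b => [th|].
  by have [/th->//|/ltW/th] := leP a b; rewrite distrC (distrC (1 + a)^-1); apply.
have a1 : 0 < 1 + a by rewrite ltr_wpDr.
have b1 : 0 < 1 + b by rewrite ltr_wpDr.
pose d := b - a; have d0 : 0 <= d by rewrite subr_ge0.
have bE : b = a + d by rewrite /d addrC subrK.
have -> : (1 + a)^-1 - (1 + b)^-1 = d / ((1 + a) * (1 + b)).
  by rewrite /d; field; rewrite !gt_eqF.
rewrite [X in _ <= _ * X]ger0_norm ?divr_ge0 ?mulr_ge0 ?(ltW a1) ?(ltW b1)//.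
have -> : expR (- a) - expR (- b) = expR (- a) * (1 - expR (- d)).
  by rewrite bE opprD expRD mulrBr mulr1.
have t0 := expR_gt0 (- d); have t1 : 1 - d <= expR (- d) by exact: expR_ge1Dx.
have t2 : expR (- d) <= 1 by rewrite -[leRHS]expR0 ler_expR oppr_le0.
have u0 := expR_gt0 (- a).
rewrite ger0_norm ?mulr_ge0 ?(ltW u0) ?subr_ge0//.
rewrite mulrA ler_pdivlMr ?mulr_gt0//.
(* The constant 8 is the product of the bounds 4 and 2 of [ua] and [td]; the
   former squares [1 + a / 2 <= expR (a / 2)]. *)
have ua : expR (- a) * (1 + a) ^+ 2 <= 4.
  have h : 1 + a / 2 <= expR (a / 2) by exact: expR_ge1Dx.
  have ea : expR a = expR (a / 2) ^+ 2.
    by rewrite expr2 -expRD; congr expR; rewrite -splitr.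
  rewrite expRN mulrC ler_pdivrMr ?expR_gt0// ea.
  by nra.
have td : (1 - expR (- d)) * (1 + d) <= 2 * d by nra.
have bd : 1 + b <= (1 + a) * (1 + d) by rewrite bE; nra.
apply: (@le_trans _ _ ((expR (- a) * (1 + a) ^+ 2) * ((1 - expR (- d)) * (1 + d)))).
  have -> : (expR (- a) * (1 + a) ^+ 2) * ((1 - expR (- d)) * (1 + d)) =
    (expR (- a) * (1 - expR (- d)) * (1 + a)) * ((1 + a) * (1 + d)) by ring.
  by rewrite [leLHS]mulrA ler_wpM2l// !mulr_ge0 ?(ltW u0) ?(ltW a1)// subr_ge0.
have -> : 8 * d = 4 * (2 * d) by ring.
by apply: ler_pM => //; rewrite mulr_ge0 ?exprn_ge0 ?(ltW u0) ?(ltW a1) ?subr_ge0// addr_ge0.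
Qed.

Definition cvec a : 'rV[R[i]]_n := \row_i (a i)%:C.

Lemma psdmx_real_udiagP P : psdmx P ->
  exists U a, [/\ U \is unitarymx, forall i, 0 <= a i & P = udiag U (cvec a)].
Proof.
move=> /psdmx_udiagP[U [v [uU v0 ->]]].
exists U, (fun i => complex.Re (v 0 i)); split; [exact: uU|move=> i|].
  by rewrite -ler0c RRe_real// ger0_real.
by congr udiag; apply/rowP => i; rewrite mxE RRe_real// ger0_real.
Qed.

(** In an eigenbasis the exponential series is a family of scalar ones. *)
Lemma conv_sum_exp_udiag U a : U \is unitarymx ->
  conv_sum (fun k => (k`!%:R)^-1 *: udiag U (cvec a) ^+ k)
    (udiag U (cvec (expR \o a))).
Proof.
move=> uU; apply/conv_sumP.
apply: (@squeeze_cvgr _ _ _ _ (fun=> 0) (fun N => norm1 (U^t*) *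
  (\sum_i `|series (exp_coeff (a i)) N - expR (a i)|) * norm1 U)).
- apply: nearW => N; rewrite norm1_ge0/=.
  have -> : \sum_(0 <= k < N) (k`!%:R)^-1 *: udiag U (cvec a) ^+ k -
      udiag U (cvec (expR \o a)) =
      udiag U (cvec (fun i => series (exp_coeff (a i)) N - expR (a i))).
    rewrite (udiag_poly (cvec a) (fun k => (k`!%:R)^-1) N uU) udiagB.
    congr udiag; apply/rowP => i; rewrite !mxE rmorphB rmorph_sum; congr (_ - _).
    apply: eq_bigr => k _; rewrite /exp_coeff/=.
    by rewrite mulrC rmorphM rmorphXn fmorphV rmorph_nat.
  rewrite /udiag; apply: le_trans (ler_norm1M _ _) _.
  rewrite ler_wpM2r ?norm1_ge0//; apply: le_trans (ler_norm1M _ _) _.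
  rewrite ler_wpM2l ?norm1_ge0// norm1_diag; apply: ler_sum => i _.
  by rewrite mxE normc_real.
- exact: cvg_cst.
- have h : \sum_i `|series (exp_coeff (a i)) N - expR (a i)| @[N --> \oo] --> (0 : R).
    apply: cvg_sum0 => i; apply/norm_cvg0P; apply/subr_cvg0.
    exact: is_cvg_series_exp_coeff.
  have h' : norm1 (U^t*) * (\sum_i `|series (exp_coeff (a i)) N - expR (a i)|) * norm1 U
      @[N --> \oo] --> norm1 (U^t*) * 0 * norm1 U.
    by apply: cvgM; [apply: cvgM => //|]; exact: cvg_cst.
  by rewrite mulr0 mul0r in h'; exact: h'.
Qed.

Lemma expmxN_udiag U a : U \is unitarymx ->
  expmx (- udiag U (cvec a)) = udiag U (cvec (fun i => expR (- a i))).
Proof.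
move=> uU; have -> : - udiag U (cvec a) = udiag U (cvec (fun i => - a i)).
  by rewrite udiagN; congr udiag; apply/rowP => i; rewrite !mxE rmorphN.
have e := conv_sum_exp_udiag (fun i => - a i) uU.
apply: xget_unique => [|y]; first exact: e.
by move=> /conv_sum_unique; apply.
Qed.

Lemma expmxN0 : expmx (- (0 : 'M[R[i]]_n)) = 1%:M.
Proof.
have u1 : (1%:M : 'M[R[i]]_n) \is unitarymx.
  by apply/unitarymxP; rewrite adjmx1 mulmx1.
have -> : (0 : 'M[R[i]]_n) = udiag 1%:M (cvec (fun=> 0)).
  by rewrite -(udiag0 1%:M); congr udiag; apply/rowP => i; rewrite !mxE.
rewrite expmxN_udiag// -[RHS](udiag1 u1); congr udiag.
by apply/rowP => i; rewrite !mxE oppr0 expR0.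
Qed.

Definition resolvent_trace P : R := complex.Re (\tr (invmx (1%:M + P))).

Lemma resolvent_trace_udiag U a : U \is unitarymx -> (forall i, 0 <= a i) ->
  resolvent_trace (udiag U (cvec a)) = \sum_i (1 + a i)^-1.
Proof.
move=> uU a0.
have ca0 i : 0 <= cvec a 0 i by rewrite mxE ler0c.
rewrite /resolvent_trace invmx_1D_udiag//.
rewrite mxtrace_udiag// (big_morph _ (raddfD (@complex.Re R)) (raddf0 _)).
apply: eq_bigr => i _; rewrite !mxE.
by rewrite -[1]/(1%:C) -rmorphD -fmorphV.
Qed.

Lemma resolvent_trace_ge0 P : psdmx P -> 0 <= resolvent_trace P.
Proof.
move=> /psdmx_real_udiagP[U [a [uU a0 ->]]]; rewrite resolvent_trace_udiag//.
by rewrite sumr_ge0// => i _; rewrite invr_ge0 addr_ge0.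
Qed.

Lemma resolvent_trace_le P : psdmx P -> resolvent_trace P <= n%:R.
Proof.
move=> /psdmx_real_udiagP[U [a [uU a0 ->]]]; rewrite resolvent_trace_udiag//.
have -> : n%:R = \sum_(i < n) (1 : R) by rewrite sumr_const card_ord.
by apply: ler_sum => i _; rewrite invf_le1 ?lerDl// ltr_wpDr.
Qed.

Lemma resolvent_trace0 : resolvent_trace 0 = n%:R.
Proof.
rewrite /resolvent_trace addr0 invmx1 mxtrace1.
by rewrite -[n%:R in LHS](rmorph_nat (real_complex R)).
Qed.

Lemma resolvent_trace_ge P : psdmx P ->
  n%:R - resolvent_trace P <= complex.Re (\tr P).
Proof.
move=> /psdmx_real_udiagP[U [a [uU a0 ->]]]; rewrite resolvent_trace_udiag//.
rewrite mxtrace_udiag// (big_morph _ (raddfD (@complex.Re R)) (raddf0 _)).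
have -> : n%:R = \sum_(i < n) (1 : R) by rewrite sumr_const card_ord.
rewrite -sumrB; apply: ler_sum => i _; rewrite mxE/=.
have a1 : 0 < 1 + a i by rewrite ltr_wpDr.
have -> : 1 - (1 + a i)^-1 = a i / (1 + a i) by field; rewrite gt_eqF.
by rewrite ler_pdivrMr// ler_peMr// lerDl.
Qed.

(** Since the right-hand side is a difference of values of one bounded function,
    these estimates add up along an increasing sequence. *)
Lemma expmxN_variation P Q : psdmx P -> psdmx Q -> psdmx (Q - P) ->
  norm1 (expmx (- P) - expmx (- Q)) <=
    n%:R ^+ 2 * 8 * (resolvent_trace P - resolvent_trace Q).
Proof.
move=> /psdmx_real_udiagP[U [a [uU a0 ->]]] /psdmx_real_udiagP[V [b [uV b0 ->]]] pD.
rewrite !expmxN_udiag// !resolvent_trace_udiag//.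
set t := \sum_i (1 + a i)^-1 - \sum_i (1 + b i)^-1.
have ca0 i : 0 <= cvec a 0 i by rewrite mxE ler0c.
have cb0 i : 0 <= cvec b 0 i by rewrite mxE ler0c.
have invC (x : R) : (1 + x%:C)^-1 = ((1 + x)^-1)%:C :> R[i].
  by rewrite fmorphV rmorphD.
have normC (x : R) : `|x%:C| = `|x|%:C :> R[i].
  by rewrite -[LHS]/((ComplexField.Normc.normc x%:C)%:C) normc_real.
have entry i j : ComplexField.Normc.normc ((udiag U (cvec (fun i => expR (- a i))) -
    udiag V (cvec (fun i => expR (- b i)))) i j) <= 8 * t.
  rewrite -lecR; have := udiagB_le_resolvent_trace
    (f := cvec (fun i => expR (- a i))) (g := cvec (fun i => expR (- b i)))
    (L := 8%:R%:C) uU uV ca0 cb0 pD.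
  have -> : \sum_k (1 + cvec a 0 k)^-1 - \sum_k (1 + cvec b 0 k)^-1 = t%:C.
    rewrite /t rmorphB !rmorph_sum; congr (_ - _);
    by apply: eq_bigr => k _; rewrite mxE invC.
  rewrite rmorphM; apply; first by rewrite ler0c.
  move=> k l; rewrite !mxE !invC -!rmorphB !normC -rmorphM lecR.
  exact: expRN_lip_resolvent.
apply: (@le_trans _ _ (\sum_(i < n) \sum_(j < n) (8 * t))).
  by apply: ler_sum => i _; apply: ler_sum => j _; exact: entry.
by rewrite !sumr_const !card_ord -mulrA expr2 -mulrnA -[leLHS]mulr_natl natrM.
Qed.

End MatrixExponential.

Lemma sum_le_telescope (R : numDomainType) (u t : nat -> R) (K : R) N :
  (forall k, u k <= K * (t k - t k.+1)) ->
  \sum_(0 <= k < N) u k <= K * (t 0%N - t N).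
Proof.
move=> ut; elim: N => [|N IH]; first by rewrite big_geq// subrr mulr0.
rewrite big_nat_recr//=; apply: le_trans (lerD IH (ut N)) _.
by rewrite -mulrDr addrA subrK.
Qed.

Lemma loewner_psdmx (R : realType) n (A B : 'M[R[i]]_n) :
  loewner_lt A B -> psdmx (B - A).
Proof.
move=> AB x; have [->|x0] := eqVneq x 0; last by apply/ltW/AB.
by rewrite mulmx0 mxE.
Qed.

Theorem corollary4p3 (R : realType) (d : nat) (P : nat -> 'M[R[i]]_d)
    (P0_pos : loewner_lt 0 (P 0%N))
    (P_incr : forall k : nat, loewner_lt (P k) (P k.+1))
    (P_unbounded : spectral_norm (P k) @[k --> \oo] --> +oo)
    (A : nat -> 'M[R[i]]_d) (S : 'M[R[i]]_d)
    (A_sum : conv_sum A S) :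
  abel_summable P A S.
Proof.
have pP k : psdmx (P k).
  elim: k => [|k IH]; first by rewrite -[P 0%N]subr0; exact: loewner_psdmx.
  exact: psdmx_le IH (loewner_psdmx (P_incr k)).
pose E x k := expmx (- (x%:C *: P k)).
pose tau x k := resolvent_trace (x%:C *: P k).
pose K : R := d%:R ^+ 2 * 8.
have K0 : 0 <= K by rewrite mulr_ge0// exprn_ge0.
have pxP x k : 0 < x -> psdmx (x%:C *: P k).
  by move=> x0; apply: psdmxZ => //; rewrite ler0c ltW.
have Evar x k : 0 < x -> norm1 (E x k - E x k.+1) <= K * (tau x k - tau x k.+1).
  move=> x0; have xC0 : 0 <= x%:C by rewrite ler0c ltW.
  have pD := psdmxZB xC0 (loewner_psdmx (P_incr k)).
  exact: expmxN_variation (pxP x k x0) (pxP x k.+1 x0) pD.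
have E1 x k : 0 < x -> norm1 (E x k - 1%:M) <= K * (d%:R - tau x k).
  move=> x0; have pk := pxP x k x0.
  have pk0 : psdmx (x%:C *: P k - 0) by rewrite subr0.
  have h := expmxN_variation (@psdmx0 _ d) pk pk0.
  by rewrite expmxN0 resolvent_trace0 in h; rewrite norm1_distC; exact: h.
have tau0 x k : 0 < x -> 0 <= tau x k.
  by move=> x0; apply: resolvent_trace_ge0; exact: pxP.
have tau1 x k : 0 < x -> d%:R - tau x k <= x * complex.Re (\tr (P k)).
  move=> x0; apply: le_trans (resolvent_trace_ge (pxP x k x0)) _.
  by rewrite mxtraceZ; case: (\tr (P k)) => u v /=; rewrite mul0r subr0.
have taud x k : 0 < x -> tau x k <= d%:R.
  by move=> x0; apply: resolvent_trace_le; exact: pxP.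
have Kd k x : 0 < x -> K * (d%:R - tau x k) <= K * d%:R.
  by move=> x0; rewrite ler_wpM2l// gerBl tau0.
(* The total variation is at most [K * d], and every [E x k] is within [K * d] of
   the identity. *)
apply: (regular_of_bounded_variation
  (c := norm1 (1%:M : 'M[R[i]]_d) + K * d%:R)) A_sum => [x N x0|x k x0|k].
- apply: le_trans (sum_le_telescope N (fun k => Evar x k x0)) _.
  rewrite -[leLHS]add0r lerD ?norm1_ge0// ler_wpM2l//.
  by rewrite lerBlDr ler_wpDr ?tau0 ?taud.
- apply: le_trans (ler_norm1_sub 1%:M _) _; rewrite lerD2l.
  exact: le_trans (E1 x k x0) (Kd k x x0).
- apply: (@squeeze_cvgr _ _ _ _ (fun=> 0) (fun x => K * (x * complex.Re (\tr (P k))))).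
  + near=> x; rewrite norm1_ge0/=.
    have x0 : 0 < x by near: x; exact: nbhs_right_gt.
    by apply: le_trans (E1 x k x0) _; rewrite ler_wpM2l// tau1.
  + exact: cvg_cst.
  + have h : K * (x * complex.Re (\tr (P k))) @[x --> 0^'+] -->
        K * (0 * complex.Re (\tr (P k))).
      apply: cvgM; first exact: cvg_cst.
      by apply: cvgM; [apply: cvg_at_right_filter; exact: cvg_id|exact: cvg_cst].
    by rewrite mul0r mulr0 in h; exact: h.
Unshelve. all: by end_near. Qed.
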